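(* Let $\Gamma$ be an inverse semigroup and let $R$ be an admissible radius function on $\Gamma$ whose extension to $\mathcal{O}(\Gamma)$ is continuous on $G_u(\Gamma)$. Then $V_{x;x_1,\ldots,x_n}$ is compact for arbitrary $x_1,\ldots,x_n\prec x$ in $\Gamma$.
   Context: In an inverse semigroup, $x\prec y$ means $xy^{-1}=xx^{-1}$ (natural partial order). The symbol $0$ denotes the (unique) element $z$ with $z\prec x$ for all $x$, if it exists; conditions ''$\neq0$'' are vacuous otherwise. An element $x$ is minimal if $x\neq0$ and $y\prec x$, $y\ne0$ implies $y=x$. A subset $A\subset\Gamma$ is directed if it is nonempty and any two elements of $A$ have a common $\prec$-lower bound in $A$. For directed sets write $A\prec B$ if for every $b\in B$ there is $a\in A$ with $a\prec b$, and $A\sim B$ if $A\prec B$ and $B\prec A$. $\mathcal{O}(\Gamma)$ is the set of $\sim$-classes $[A]$ of directed sets; with $[A][B]=[AB]$ and $[A]^{-1}=[A^{-1}]$ (elementwise) it is an inverse semigroup whose natural order is $[A]\prec[B]\iff A\prec B$. For $x\in\Gamma$ write $x$ also for $[\{x\}]$. $\mathcal{O}(\Gamma)_{\min}$ is the set of minimal elements of $\mathcal{O}(\Gamma)$. $G_u(\Gamma)$ is the groupoid with underlying set $\mathcal{O}(\Gamma)$, the inversion of $\mathcal{O}(\Gamma)$, and product $XY$ defined iff $X^{-1}X=YY^{-1}$. For $x_1,\ldots,x_n\prec x$ in $\Gamma$ ($n\ge0$), with $U_x=\{X:X\prec x\}$, put $U_{x;x_1,\ldots,x_n}=U_x\cap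 U_{x_1}^c\cap\cdots\cap U_{x_n}^c$; these sets are a basis of the topology of $G_u(\Gamma)$. $G_m(\Gamma)$ is the subgroupoid of $G_u(\Gamma)$ with underlying set $\mathcal{O}(\Gamma)_{\min}$ and the subspace topology, and $V_{x;x_1,\ldots,x_n}=U_{x;x_1,\ldots,x_n}\cap G_m(\Gamma)$. A function $R:\Gamma\to I$ with $I=[0,\infty)$ or $I=[0,\infty]$ is a radius function if $R(x^{-1})=R(x)$, $R(xy)\ge\min\{R(x),R(y)\}$, and $R(y)\le R(x)$ whenever $x\prec y$. It is extended to $\mathcal{O}(\Gamma)$ by $R(X)=\sup\{R(x):x\in\Gamma, X\prec x\}\in[0,\infty]$. It is admissible if for $X\in\mathcal{O}(\Gamma)$: $R(X)=\infty$ if and only if $X\in\mathcal{O}(\Gamma)_{\min}$. Continuity refers to the usual topology of $[0,\infty]$. *)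

(* Defs.v *)
From HB Require Import structures.
From mathcomp Require Import all_boot all_order all_algebra.
From mathcomp Require Import all_classical reals topology ereal.

Set Implicit Arguments.
Unset Strict Implicit.
Unset Printing Implicit Defensive.

Local Open Scope group_scope.
Local Open Scope classical_set_scope.
Local Open Scope quotient_scope.

(* [Algebra.inv] of MathComp needs a unit element, hence a separate inversion. *)
HB.mixin Record Semigroup_isInverse S of Semigroup S := {
  sinv : S -> S;
  mulgsVg : forall x : S, x * sinv x * x = x;
  mulsVgsV : forall x : S, sinv x * x * sinv x = sinv x;
  sinv_uniq : forall x y : S, x * y * x = x -> y * x * y = y -> y = sinv x
}.

#[short(type="inverseSemigroupType")]
HB.structure Definition InverseSemigroup :=
  {S of Semigroup_isInverse S & Semigroup S}.

Notation "x ⁻¹" := (sinv x) (at level 1, left associativity, format "x ⁻¹").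

Definition natle (S : inverseSemigroupType) (x y : S) : Prop :=
  x * y⁻¹ = x * x⁻¹.

Notation "x ≺ y" := (natle x y) (at level 70, no associativity).

Section NaturalOrderNotions.
Variable S : inverseSemigroupType.
Implicit Types x y z : S.

Definition is_zero z : Prop := forall x, z ≺ x.

(* If S has no zero, both conditions "nonzero" hold automatically. *)
Definition minimal x : Prop :=
  ~ is_zero x /\ forall y, y ≺ x -> ~ is_zero y -> y = x.

End NaturalOrderNotions.

Section InverseSemigroupTheory.
Variable S : inverseSemigroupType.
Implicit Types x y z e f : S.

Lemma sinvK : involutive (@sinv S).
Proof. by move=> x; apply/esym/sinv_uniq; rewrite ?mulgsVg ?mulsVgsV. Qed.

Lemma idem_sinv e : e * e = e -> e⁻¹ = e.
Proof. by move=> ee; apply/esym/sinv_uniq; rewrite !ee. Qed.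

Lemma idem_mul e f : e * e = e -> f * f = f -> e * f * (e * f) = e * f.
Proof.
move=> ee ff; set g := (e * f)⁻¹.
have gef : g * e * f * g = g by rewrite -[RHS](mulsVgsV (e * f)) -/g !mulgA.
have gE : f * g * e = g.
  apply: sinv_uniq.
    rewrite -[RHS](mulgsVg (e * f)) -/g !mulgA.
    by rewrite -(mulgA e f f) ff -(mulgA _ e e) ee.
  rewrite !mulgA -(mulgA _ e e) ee -(mulgA _ f f) ff.
  by rewrite -(mulgA f g e) -(mulgA f _ f) -(mulgA f _ g) gef mulgA.
have gg : g * g = g.
  rewrite -{1 2}gE !mulgA.
  by rewrite -(mulgA f g e) -(mulgA f _ f) -(mulgA f _ g) gef.
by have -> : e * f = g by rewrite -(idem_sinv gg) /g sinvK.
Qed.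

Lemma idemC e f : e * e = e -> f * f = f -> e * f = f * e.
Proof.
move=> ee ff; have efI := idem_mul ee ff; have feI := idem_mul ff ee.
rewrite -[LHS](idem_sinv efI); apply/esym/sinv_uniq.
  by rewrite !mulgA -(mulgA e f f) ff -(mulgA _ e e) ee -mulgA efI.
by rewrite !mulgA -(mulgA f e e) ee -(mulgA _ f f) ff -mulgA feI.
Qed.

Lemma idem_gsV x : x * x⁻¹ * (x * x⁻¹) = x * x⁻¹.
Proof. by rewrite mulgA mulgsVg. Qed.

Lemma idem_sVg x : x⁻¹ * x * (x⁻¹ * x) = x⁻¹ * x.
Proof. by rewrite mulgA mulsVgsV. Qed.

Lemma sinvM x y : (x * y)⁻¹ = y⁻¹ * x⁻¹.
Proof.
have C := idemC (idem_gsV y) (idem_sVg x).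
apply/esym/sinv_uniq.
  transitivity (x * (y * y⁻¹ * (x⁻¹ * x)) * y); first by rewrite !mulgA.
  by rewrite C !mulgA mulgsVg -!mulgA (mulgA y) mulgsVg.
transitivity (y⁻¹ * (x⁻¹ * x * (y * y⁻¹)) * x⁻¹); first by rewrite !mulgA.
by rewrite -C !mulgA mulsVgsV -!mulgA (mulgA x⁻¹) mulsVgsV.
Qed.

Lemma conj_idem y f : f * f = f -> y * f * y⁻¹ * (y * f * y⁻¹) = y * f * y⁻¹.
Proof.
move=> ff; have C := idemC ff (idem_sVg y).
transitivity (y * (f * (y⁻¹ * y)) * f * y⁻¹); first by rewrite !mulgA.
by rewrite C !mulgA mulgsVg -(mulgA y f f) ff.
Qed.

Lemma natle_idemr x y : x ≺ y -> x = y * (x⁻¹ * x).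
Proof.
by move=> /(congr1 (@sinv S)); rewrite !sinvM !sinvK mulgA => ->; rewrite mulgsVg.
Qed.

Lemma natleMl e y : e * e = e -> e * y ≺ y.
Proof.
move=> ee; rewrite /natle sinvM (idem_sinv ee).
transitivity (e * (y * y⁻¹ * e)); last by rewrite !mulgA.
by rewrite -(idemC ee (idem_gsV y)) !mulgA ee.
Qed.

Lemma natleMr f y : f * f = f -> y * f ≺ y.
Proof.
move=> ff; have -> : y * f = y * f * y⁻¹ * y.
  by rewrite -!mulgA (idemC ff (idem_sVg y)) !mulgA mulgsVg.
exact/natleMl/conj_idem.
Qed.

Lemma natle_ideml x y : x ≺ y -> x = x * x⁻¹ * y.
Proof.
move=> xy; rewrite -xy {2}(natle_idemr xy).
transitivity (y * (x⁻¹ * x * (y⁻¹ * y))); last by rewrite !mulgA.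
by rewrite (idemC (idem_sVg x) (idem_sVg y)) !mulgA mulgsVg -mulgA -(natle_idemr xy).
Qed.

Lemma natle_refl x : x ≺ x. Proof. by []. Qed.

Lemma natleP x y : x ≺ y <-> exists2 e, e * e = e & x = e * y.
Proof.
split=> [/natle_ideml xy|[e ee ->]]; last exact: natleMl.
by exists (x * x⁻¹) => //; exact: idem_gsV.
Qed.

Lemma natle_trans y x z : x ≺ y -> y ≺ z -> x ≺ z.
Proof.
move=> /natleP[e ee ->] /natleP[f ff ->].
by rewrite mulgA; apply/natleMl/idem_mul.
Qed.

Lemma natle_anti x y : x ≺ y -> y ≺ x -> x = y.
Proof.
move=> /natleP[e ee xy] /natleP[f ff yx].
have fey : f * (e * y) = y by rewrite -xy -yx.
have ey : e * y = y.
  by rewrite -[in LHS]fey mulgA mulgA (idemC ee ff) -(mulgA f) ee -mulgA.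
by rewrite xy ey.
Qed.

Lemma natle_mul x x' y y' : x ≺ x' -> y ≺ y' -> x * y ≺ x' * y'.
Proof.
move=> /natleP[e ee ->] /natle_idemr ->.
apply: (@natle_trans (e * (x' * y'))); last exact: natleMl.
by rewrite !mulgA -(mulgA _ y⁻¹); exact/natleMr/idem_sVg.
Qed.

Lemma natle_inv x y : x ≺ y -> x⁻¹ ≺ y⁻¹.
Proof.
by move=> /natleP[e ee ->]; rewrite sinvM (idem_sinv ee); exact: natleMr.
Qed.

(* Two elements below x have the meet y * (z⁻¹ * z). *)
Lemma natle_meet x y z w : y ≺ x -> z ≺ x -> w ≺ y -> w ≺ z -> w ≺ y * (z⁻¹ * z).
Proof.
move=> yx zx wy wz; rewrite -{1}(mulgsVg w) -mulgA.
apply: natle_mul => //; apply: natle_mul => //; exact: natle_inv.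
Qed.

Lemma natle_meetl y z : y * (z⁻¹ * z) ≺ y.
Proof. exact/natleMr/idem_sVg. Qed.

Lemma natle_meetr x y z : y ≺ x -> z ≺ x -> y * (z⁻¹ * z) ≺ z.
Proof.
move=> /natleP[e ee ->] /natle_idemr zx; rewrite -mulgA -zx; exact: natleMl.
Qed.

End InverseSemigroupTheory.

Section DirectedSets.
Variable S : inverseSemigroupType.
Implicit Types (x y : S) (A B C : set S).

Definition directed A : Prop :=
  A !=set0 /\ forall a b, A a -> A b -> exists c, [/\ A c, c ≺ a & c ≺ b].

Definition dirle A B : Prop := forall b, B b -> exists2 a, A a & a ≺ b.

Definition set_mulg A B : set S := [set x | exists a b, [/\ A a, B b & x = a * b]].

Definition set_sinv A : set S := [set x | exists2 a, A a & x = a⁻¹].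

Lemma dirle_refl A : dirle A A.
Proof. by move=> a Aa; exists a. Qed.

Lemma dirle_trans B A C : dirle A B -> dirle B C -> dirle A C.
Proof.
move=> AB BC c /BC[b /AB[a Aa ab] bc]; exists a => //; exact: natle_trans bc.
Qed.

Lemma dirle_mulg A A' B B' :
  dirle A A' -> dirle B B' -> dirle (set_mulg A B) (set_mulg A' B').
Proof.
move=> AA BB _ [a' [b' [/AA[a Aa aa] /BB[b Bb bb] ->]]].
by exists (a * b); [exists a, b | exact: natle_mul].
Qed.

Lemma dirle_sinv A B : dirle A B -> dirle (set_sinv A) (set_sinv B).
Proof.
move=> AB _ [b /AB[a Aa ab] ->]; exists a⁻¹; [by exists a | exact: natle_inv].
Qed.

Lemma directed1 x : directed [set x].
Proof. by split; [exists x | move=> _ _ -> ->; exists x; split]. Qed.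

Lemma directed_mulg A B : directed A -> directed B -> directed (set_mulg A B).
Proof.
move=> [[a Aa] dA] [[b Bb] dB]; split; first by exists (a * b), a, b.
move=> _ _ [a1 [b1 [Aa1 Bb1 ->]]] [a2 [b2 [Aa2 Bb2 ->]]].
have [a3 [Aa3 a31 a32]] := dA _ _ Aa1 Aa2.
have [b3 [Bb3 b31 b32]] := dB _ _ Bb1 Bb2.
by exists (a3 * b3); split; [exists a3, b3 | exact: natle_mul | exact: natle_mul].
Qed.

Lemma directed_sinv A : directed A -> directed (set_sinv A).
Proof.
move=> [[a Aa] dA]; split; first by exists a⁻¹, a.
move=> _ _ [a1 Aa1 ->] [a2 Aa2 ->]; have [c [Ac c1 c2]] := dA _ _ Aa1 Aa2.
by exists c⁻¹; split; [exists c | exact: natle_inv | exact: natle_inv].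
Qed.

Record dirset := Dirset { dirset_set :> set S; dirsetP : directed dirset_set }.

HB.instance Definition _ := gen_eqMixin dirset.
HB.instance Definition _ := gen_choiceMixin dirset.

Definition dirset1 x := Dirset (directed1 x).
Definition dirset_mul (A B : dirset) := Dirset (directed_mulg (dirsetP A) (dirsetP B)).
Definition dirset_inv (A : dirset) := Dirset (directed_sinv (dirsetP A)).

Definition direq (A B : dirset) : bool := `[< dirle A B /\ dirle B A >].

Lemma direq_refl : reflexive direq.
Proof. by move=> A; apply/asboolP; split; exact: dirle_refl. Qed.

Lemma direq_sym : symmetric direq.
Proof. by move=> A B; apply/asboolP/asboolP => -[]. Qed.

Lemma direq_trans : transitive direq.
Proof.
move=> B A C /asboolP[AB BA] /asboolP[BC CB]; apply/asboolP.
by split; apply: (@dirle_trans B).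
Qed.

Canonical direq_equiv := EquivRel direq direq_refl direq_sym direq_trans.

Definition calO : Type := {eq_quot direq}.
HB.instance Definition _ := Choice.on calO.
HB.instance Definition _ := EqQuotient.on calO.

End DirectedSets.

Section CalOInverseSemigroup.
Variable S : inverseSemigroupType.
Implicit Types (x y : S) (A B C : dirset S) (X Y Z : calO S).

Definition dirclass A : calO S := \pi_(calO S) A.

Lemma dirclass_eq A B : dirclass A = dirclass B <-> dirle A B /\ dirle B A.
Proof.
split=> [/eqP|AB]; first by rewrite eqmodE => /asboolP.
by apply/eqP; rewrite eqmodE; apply/asboolP.
Qed.

Lemma calO_ind (P : calO S -> Prop) : (forall A, P (dirclass A)) -> forall X, P X.
Proof. by move=> PA X; rewrite -[X]reprK; exact: PA. Qed.

Lemma dirclass_repr A : dirle A (repr (dirclass A)) /\ dirle (repr (dirclass A)) A.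
Proof. by apply/dirclass_eq; rewrite [RHS]reprK. Qed.

Definition calO_mul X Y : calO S := dirclass (dirset_mul (repr X) (repr Y)).
Definition calO_inv X : calO S := dirclass (dirset_inv (repr X)).

Lemma calO_mulE A B :
  calO_mul (dirclass A) (dirclass B) = dirclass (dirset_mul A B).
Proof.
have [A1 A2] := dirclass_repr A; have [B1 B2] := dirclass_repr B.
by apply/dirclass_eq; split; exact: dirle_mulg.
Qed.

Lemma calO_invE A : calO_inv (dirclass A) = dirclass (dirset_inv A).
Proof.
have [A1 A2] := dirclass_repr A.
by apply/dirclass_eq; split; exact: dirle_sinv.
Qed.

Lemma calO_mulA : associative calO_mul.
Proof.
elim/calO_ind=> A; elim/calO_ind=> B; elim/calO_ind=> C.
rewrite !calO_mulE; apply/dirclass_eq; split.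
  move=> _ [_ [c [[a [b [Aa Bb ->]]] Cc ->]]]; exists (a * (b * c)).
    by exists a, (b * c); split=> //; exists b, c.
  by rewrite mulgA.
move=> _ [a [_ [Aa [b [c [Bb Cc ->]]] ->]]]; exists (a * b * c).
  by exists (a * b), c; split=> //; exists a, b.
by rewrite mulgA.
Qed.

Let common A a b : dirset_set A a -> dirset_set A b ->
  exists c, [/\ dirset_set A c, c ≺ a & c ≺ b].
Proof. by case: A => A [? dA]; exact: dA. Qed.

Let point A : exists a, dirset_set A a.
Proof. by case: A => A [[a Aa] ?]; exists a. Qed.

Lemma calO_mulgsVg X : calO_mul (calO_mul X (calO_inv X)) X = X.
Proof.
elim/calO_ind: X => A; rewrite calO_invE !calO_mulE; apply/dirclass_eq; split.
  move=> a Aa; exists (a * a⁻¹ * a); last by rewrite mulgsVg.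
  exists (a * a⁻¹), a; split=> //; exists a, a⁻¹; split=> //; by exists a.
move=> _ [_ [a3 [[a1 [_ [Aa1 [a2 Aa2 ->] ->]]] Aa3 ->]]].
have [b [Ab b1 b2]] := common Aa1 Aa2; have [c [Ac cb c3]] := common Ab Aa3.
exists c => //; rewrite -{1}(mulgsVg c); apply: natle_mul => //.
apply: natle_mul; first exact: natle_trans b1.
by apply: natle_inv; exact: natle_trans b2.
Qed.

Lemma calO_invK : involutive calO_inv.
Proof.
elim/calO_ind => A; rewrite !calO_invE; apply/dirclass_eq; split.
  by move=> a Aa; exists a => //; exists a⁻¹; [exists a | rewrite sinvK].
by move=> _ [_ [a Aa ->] ->]; exists a => //; rewrite sinvK.
Qed.

Lemma calO_mulsVgsV X : calO_mul (calO_mul (calO_inv X) X) (calO_inv X) = calO_inv X.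
Proof. by rewrite -{2}[X]calO_invK calO_mulgsVg. Qed.

Let inv_le A B : dirclass A = calO_mul (calO_mul (dirclass A) (dirclass B)) (dirclass A) ->
  dirle (dirset_inv A) B.
Proof.
rewrite !calO_mulE => /dirclass_eq[H _] b Bb; have [a Aa] := point A.
have [|a1 Aa1 a1le] := H (a * b * a).
  by exists (a * b), a; split=> //; exists a, b.
have [c [Ac ca ca1]] := common Aa Aa1.
exists c⁻¹; first by exists c.
have cle := natle_trans ca1 a1le.
have cV := natle_inv ca.
have le1 : c⁻¹ * c * c⁻¹ ≺ c⁻¹ * (a * b * a) * c⁻¹.
  by apply: natle_mul => //; exact: natle_mul.
rewrite -(mulsVgsV c); apply: (natle_trans le1).
have E1 : c⁻¹ * a = c⁻¹ * c.
  by have := cV; rewrite /natle !sinvK.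
have E2 : a * c⁻¹ = c * c⁻¹.
  by have /(congr1 (@sinv S)) := ca; rewrite !sinvM !sinvK.
rewrite !mulgA E1 -(mulgA _ a) E2.
apply: (@natle_trans _ (c⁻¹ * c * b)); last exact/natleMl/idem_sVg.
exact/natleMr/idem_gsV.
Qed.

Lemma calO_inv_uniq X Y : calO_mul (calO_mul X Y) X = X ->
  calO_mul (calO_mul Y X) Y = Y -> Y = calO_inv X.
Proof.
elim/calO_ind: X => A; elim/calO_ind: Y => B.
move=> /esym/inv_le AB /esym/inv_le BA; rewrite calO_invE.
apply/dirclass_eq; split=> // _ [a /BA[_ [b Bb ->] ba] ->].
by exists b => //; rewrite -[b]sinvK; exact: natle_inv.
Qed.

HB.instance Definition _ := isSemigroup.Build (calO S) calO_mulA.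
HB.instance Definition _ := Semigroup_isInverse.Build (calO S)
  calO_mulgsVg calO_mulsVgsV calO_inv_uniq.

Lemma dirclassM A B : dirclass A * dirclass B = dirclass (dirset_mul A B).
Proof. exact: calO_mulE. Qed.

Lemma dirclassV A : (dirclass A)⁻¹ = dirclass (dirset_inv A).
Proof. exact: calO_invE. Qed.

Lemma dirclass_le A B : dirclass A ≺ dirclass B <-> dirle A B.
Proof.
split=> [/natle_ideml|AB].
  rewrite dirclassV (dirclassM A) (dirclassM (dirset_mul A _)) => /dirclass_eq[H _] b Bb; have [a Aa] := point A.
  have [|c Ac cle] := H (a * a⁻¹ * b).
    exists (a * a⁻¹), b; split=> //; exists a, a⁻¹; split=> //; by exists a.
  by exists c => //; apply: (natle_trans cle); exact/natleMl/idem_gsV.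
rewrite /natle !dirclassV !dirclassM; apply/dirclass_eq; split.
  move=> _ [a1 [_ [Aa1 [a2 Aa2 ->] ->]]].
  have [a3 [Aa3 a31 a32]] := common Aa1 Aa2; have [b Bb] := point B.
  have [a4 Aa4 a4b] := AB _ Bb; have [c [Ac c4 c3]] := common Aa4 Aa3.
  exists (c * b⁻¹); first by exists c, b⁻¹; split=> //; exists b.
  rewrite (natle_trans c4 a4b).
  by apply: natle_mul; [|apply: natle_inv]; apply: (natle_trans c3).
move=> _ [a [_ [Aa [b Bb ->] ->]]].
have [a1 Aa1 a1b] := AB _ Bb; have [c [Ac c1 ca]] := common Aa1 Aa.
exists (c * c⁻¹); first by exists c, c⁻¹; split=> //; exists c.
by apply: natle_mul => //; apply: natle_inv; exact: natle_trans c1 a1b.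
Qed.

Definition calO_of (x : S) : calO S := dirclass (dirset1 x).

Lemma dirclass_le1 A x : dirclass A ≺ calO_of x <-> exists2 a, dirset_set A a & a ≺ x.
Proof.
rewrite dirclass_le; split=> [/(_ x erefl)//|[a Aa ax] _ ->]; by exists a.
Qed.

Lemma calO_le_ex X : exists x, X ≺ calO_of x.
Proof.
by elim/calO_ind: X => A; have [a Aa] := point A; exists a; apply/dirclass_le1; exists a.
Qed.

Lemma calO_of_le x y : x ≺ y -> calO_of x ≺ calO_of y.
Proof. by move=> xy; apply/dirclass_le1; exists x. Qed.

Lemma calO_le_common X x y : X ≺ calO_of x -> X ≺ calO_of y ->
  exists z, [/\ X ≺ calO_of z, z ≺ x & z ≺ y].
Proof.
elim/calO_ind: X => A /dirclass_le1[a Aa ax] /dirclass_le1[b Ab bY].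
have [c [Ac ca cb]] := common Aa Ab; exists c.
split; [by apply/dirclass_le1; exists c|exact: natle_trans ca ax|exact: natle_trans cb bY].
Qed.

Lemma calO_le_meet X x y z : y ≺ x -> z ≺ x -> X ≺ calO_of y -> X ≺ calO_of z ->
  X ≺ calO_of (y * (z⁻¹ * z)).
Proof.
move=> yx zx Xy Xz; have [w [Xw wy wz]] := calO_le_common Xy Xz.
exact: natle_trans Xw (calO_of_le (natle_meet yx zx wy wz)).
Qed.

End CalOInverseSemigroup.

(* An alias of the carrier, so that the topology lives on the groupoid only; the
   partial product is the one of [calO S] restricted to X⁻¹ * X = Y * Y⁻¹. *)
Definition Gu (S : inverseSemigroupType) : Type := calO S.

Section Topology.
Variable S : inverseSemigroupType.
Implicit Types (x : S) (xs : seq S).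

HB.instance Definition _ := InverseSemigroup.on (Gu S).

Definition Uprincipal x : set (Gu S) := [set X : Gu S | X ≺ calO_of x].

Definition Ubasic x xs : set (Gu S) := Uprincipal x `&` \bigcap_(y in [set` xs]) ~` Uprincipal y.

Definition Ubase : set_system (Gu S) :=
  [set V | exists x xs, {in xs, forall y, y ≺ x} /\ V = Ubasic x xs].

Lemma Ubase_cover : \bigcup_(V in Ubase) id V = setT.
Proof.
apply/seteqP; split=> // X _; have [x Xx] := calO_le_ex X.
by exists (Ubasic x [::]); [exists x, [::] | split=> // y].
Qed.

Lemma Ubase_join V W X : Ubase V -> Ubase W -> id V X -> id W X ->
  exists T, [/\ Ubase T, id T X & id T `<=` id V `&` id W].
Proof.
move=> [x [xs [xsx ->]]] [y [ys [ysy ->]]] [Xx Xxs] [Xy Xys].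
have [z [Xz zx zy]] := calO_le_common Xx Xy.
exists (Ubasic z [seq w * (z⁻¹ * z) | w <- xs ++ ys]); split.
- exists z, [seq w * (z⁻¹ * z) | w <- xs ++ ys]; split=> // _ /mapP[w + ->].
  rewrite mem_cat => /orP[/xsx wx|/ysy wy]; [exact: natle_meetr wx zx|].
  exact: natle_meetr wy zy.
- split=> // _ /mapP[w + ->] Xw; rewrite mem_cat.
  have {}Xw : X ≺ calO_of w.
    by apply: natle_trans Xw _; apply/calO_of_le/natle_meetl.
  by move=> /orP[/Xxs|/Xys]; exact.
- move=> Y [Yz Yn].
  split; split.
  + exact: natle_trans Yz (calO_of_le zx).
  + move=> w /= wxs Yw; apply: (Yn (w * (z⁻¹ * z))).
      by apply/mapP; exists w => //; rewrite mem_cat wxs.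
    exact: calO_le_meet (xsx _ wxs) zx Yw Yz.
  + exact: natle_trans Yz (calO_of_le zy).
  + move=> w /= wys Yw; apply: (Yn (w * (z⁻¹ * z))).
      by apply/mapP; exists w => //; rewrite mem_cat wys orbT.
    exact: calO_le_meet (ysy _ wys) zy Yw Yz.
Qed.

HB.instance Definition _ := isBaseTopological.Build (Gu S) Ubase_cover
  (fun V W X hV hW => @Ubase_join V W X hV hW).

Definition calOmin : set (Gu S) := [set X | minimal X].

(* The type of elements of a set carries the initial topology of [set_val]. *)
Definition Gm : topologicalType := set_type calOmin.

Definition Vbasic x xs : set Gm := set_val @^-1` Ubasic x xs.

End Topology.

Section RadiusFunctions.
Variables (S : inverseSemigroupType) (K : realType).
Local Open Scope ereal_scope.

(* This covers both codomains [0, oo[ (R never takes the value +oo) and [0, oo]. *)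
Record radius_function (R : S -> \bar K) : Prop := RadiusFunction {
  radius_ge0 : forall x, 0 <= R x;
  radiusV : forall x, R x⁻¹ = R x;
  radiusM : forall x y, Order.min (R x) (R y) <= R (x * y)%g;
  radius_anti : forall x y, x ≺ y -> R y <= R x
}.

Definition radius_ext (R : S -> \bar K) (X : Gu S) : \bar K :=
  ereal_sup [set R x | x in [set x | X ≺ calO_of x]].

Definition admissible (R : S -> \bar K) : Prop :=
  forall X : Gu S, radius_ext R X = +oo <-> calOmin X.

End RadiusFunctions.

(* Main.v *)
Require Import Defs.
From mathcomp Require Import all_boot all_order all_algebra.
From mathcomp Require Import all_classical reals topology ereal.
From mathcomp Require Import ereal_normedtype.

(** An ultrafilter [F] on [Gu S] containing [U_x]
    converges to the class of the directed set [{y ≺ x : U_y ∈ F}]; so every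
    [U_(x; x_1, .., x_n)] is compact. By admissibility the minimal elements are
    the preimage of [+oo] under the extended radius, hence closed in [Gu S] by
    continuity, and [V_(x; x_1, .., x_n)] is the intersection of a compact set
    with a closed one. *)

Local Open Scope group_scope.
Local Open Scope classical_set_scope.

(** The filter pushed forward along [set_val] clusters at some [p] in [M]. Every neighborhood of [p]
    in the subspace contains the trace of an open set of [T], so [p] is a cluster point there
    too. *)
Lemma compact_set_val_preimage {T : topologicalType} (M A : set T) :
  compact (A `&` M) -> compact (set_val @^-1` A : set (set_type M)).
Proof.
move=> cAM F FF FA.
have FAM : F (set_val @^-1` (A `&` M)).
  apply: filterS FA => z Az; split; first exact: Az.
  by rewrite set_valE; exact: set_mem (valP z).
have [p [[Ap Mp] clp]] := cAM _ (fmap_proper_filter _ FF) FAM.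
exists (exist _ p (mem_set Mp)); split; first exact: Ap.
move=> B N FB [_ [[O oO <-] /= Op ON]].
have FBi : F (set_val @^-1` (set_val @` B)) by apply: filterS FB => z Bz; exists z.
have [_ [[z Bz <-] Oz]] := clp _ _ FBi (open_nbhs_nbhs (conj oO Op)).
by exists z; split=> //; exact: ON.
Qed.

(** The common bound [x] makes [y * (z⁻¹ * z)] the meet of [y] and [z]; whatever lies below both
    lies below it. *)
Lemma Uprincipal_meet {S : inverseSemigroupType} (F : set_system (Gu S)) (x y z : S) :
  Filter F -> y ≺ x -> z ≺ x -> F (Uprincipal y) -> F (Uprincipal z) ->
  exists w, [/\ w ≺ y, w ≺ z & F (Uprincipal w)].
Proof.
move=> FF yx zx Fy Fz; exists (y * (z⁻¹ * z)); split.
- exact: natle_meetl.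
- exact: natle_meetr zx.
- by apply: filterS2 Fy Fz => X Xy Xz; exact: (calO_le_meet yx zx Xy Xz).
Qed.

Lemma Gu_nbhs_Ubasic {S : inverseSemigroupType} (X : Gu S) (N : set (Gu S)) :
  nbhs X N -> exists x xs,
    [/\ {in xs, forall y, y ≺ x}, Ubasic x xs X & Ubasic x xs `<=` N].
Proof.
rewrite nbhsE => -[O [[D subD <-] [V DV VX]] ON].
have [x [xs [xs_le VE]]] := subD _ DV.
exists x, xs; split=> //; first by rewrite -VE.
by apply: subset_trans ON; rewrite -VE => Y VY; exists V.
Qed.

Lemma compact_Ubasic {S : inverseSemigroupType} (x : S) (xs : seq S) :
  compact (Ubasic x xs).
Proof.
rewrite compact_ultra => F FU FV.
have Fx : F (Uprincipal x) by apply: filterS FV => X [].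
pose A : set S := [set y | y ≺ x /\ F (Uprincipal y)].
have dA : directed A.
  split; first by exists x.
  move=> a b [ax Fa] [bx Fb].
  have [c [ca cb Fc]] := Uprincipal_meet _ _ _ _ _ ax bx Fa Fb.
  by exists c; split=> //; split=> //; exact: natle_trans ca ax.
pose X : Gu S := dirclass (Dirset dA).
have XF y : X ≺ calO_of y -> F (Uprincipal y).
  move=> /dirclass_le1[a [_ Fa] ay]; apply: filterS Fa => Y Ya.
  exact: natle_trans Ya (calO_of_le ay).
(* A converse of [XF] for [z] under some [y] above [X]: this [y] bounds both [z] and an element of
   [A], so their meet exists, and it belongs to [A]. *)
have FX y z : z ≺ y -> X ≺ calO_of y -> F (Uprincipal z) -> X ≺ calO_of z.
  move=> zy /dirclass_le1[a [ax Fa] ay] Fz.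
  have [w [wa wz Fw]] := Uprincipal_meet _ _ _ _ _ ay zy Fa Fz.
  apply/dirclass_le1; exists w => //; split=> //; exact: natle_trans wa ax.
exists X; split.
  split=> [|y yxs /= /XF Fy]; first by apply/dirclass_le1; exists x.
  (* If [X] were below an excluded [y], then [Uprincipal y] would be in [F], yet it is disjoint from
     [Ubasic x xs]. *)
  have [Y [[_ /(_ y yxs)]]] := filter_ex (filterI FV Fy); exact.
move=> N /Gu_nbhs_Ubasic[y [ys [ys_le [Xy Xys] yN]]].
apply: filterS yN _; apply: filterI; first exact: XF.
elim: ys ys_le Xys => [|z ys IH] ys_le Xys.
  by apply: filterS filterT => Y _ w.
(* The ultrafilter contains [Uprincipal z] or its complement; by [FX] the former would put [X] below
   [z]. *)
have FC : F (~` Uprincipal z).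
  have [Fz|//] := in_ultra_setVsetC (Uprincipal z) FU.
  case: (Xys z (mem_head z ys)); apply: FX _ Xy Fz.
  by apply: ys_le; exact: mem_head.
have {}IH := IH (fun w wys => ys_le w (@mem_behead _ (z :: ys) w wys))
                (fun w wys => Xys w (@mem_behead _ (z :: ys) w wys)).
apply: filterS2 FC IH => Y nYz nYys w; rewrite /= in_cons => /predU1P[->//|].
exact: nYys.
Qed.

Lemma closed_calOmin {K : realType} {S : inverseSemigroupType} (R : S -> \bar K) :
  admissible R -> continuous (radius_ext R : Gu S -> \bar K) ->
  closed (@calOmin S).
Proof.
move=> admR contR.
have -> : @calOmin S = radius_ext R @^-1` [set +oo%E].
  by apply/seteqP; split=> X /admR.
move/continuous_closedP: contR; apply; apply: accessible_closed_set1.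
exact/hausdorff_accessible/ereal_hausdorff.
Qed.

Theorem proposition6p4 (K : realType) (S : inverseSemigroupType) (R : S -> \bar K)
    (radR : radius_function R) (admR : admissible R)
    (contR : continuous (radius_ext R : Gu S -> \bar K))
    (x : S) (xs : seq S) (xs_le : forall y, y \in xs -> y ≺ x) :
  compact (Vbasic x xs).
Proof.
(* The question moves from the subspace to [Gu S], where [calOmin] is closed. *)
apply: compact_set_val_preimage; apply: compact_closedI.
  exact: compact_Ubasic.
exact: closed_calOmin admR contR.
Qed.
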